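(* Let $\Sigma\in\mathbb{R}^{n\times n}$ ($n\ge 2$) be a symmetric positive definite matrix whose concentration graph $\mathcal G(\Sigma)$ is a tree $T=([n],E)$ with maximum degree $\Delta(T)\le d$. Fix $\epsilon\in(0,1)$ and let the parameter of the subroutine $\mathtt{sCentral}$ be $\kappa=\left\lceil 32\log\left(\frac{2n^2}{\epsilon}\right)\right\rceil$. Then, with probability at least $1-\epsilon$, the algorithm $\mathtt{ReconstructTree}([n])$ requires time and a number of covariance queries both of order $$\mathcal{O}\left(n\log(n)\,\max\left\{\log\left(\frac{n}{\epsilon}\right),\,d\right\}\right),$$ where the implied constant is absolute.
   Context: Notation: $[n]=\{1,\dots,n\}$, $\Sigma=[\sigma_{ij}]$, $K=\Sigma^{-1}$. The concentration graph $\mathcal G(\Sigma)$ is the graph on $[n]$ with an edge $ij$ ($i\ne j$) iff $K_{ij}\neq 0$. Entries of $\Sigma$ are accessed only through a covariance oracle, which on input a pair $(i,j)$ returns $\sigma_{ij}$; the query complexity is the number of oracle calls. Time is the number of elementary operations (oracle calls, real arithmetic and comparisons, uniform sampling of a vertex, each at unit cost). Write $\rho_{uw}=\sigma_{uw}/\sqrt{\sigma_{uu}\sigma_{ww}}$. Algorithm $\mathtt{sCentral}(V)$, for $V\subseteq[n]$, with integer parameter $\kappa$: for each $v\in V$ set $\hat s(v)=0$ and repeat $\kappa$ times: pick $u,w$ independently and uniformly at random in $V\setminus\{v\}$ (all draws independent) and, if $\sigma_{uv}\sigma_{vw}-\sigma_{uw}\sigma_{vv}\ne 0$, increase $\hat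 s(v)$ by $1/\kappa$. Return a vertex $v\in V$ minimizing $\hat s(v)$. Algorithm $\mathtt{ComponentsTree}(V)$: let $w=\mathtt{sCentral}(V)$, $N=\emptyset$. Sort the vertices $u\in V\setminus\{w\}$ in decreasing order of $|\rho_{uw}|$. Process the vertices $u$ in this order: for each $v\in N$ test whether $\sigma_{uv}\sigma_{ww}-\sigma_{uw}\sigma_{vw}\neq 0$, and if so add $u$ to $V_v$; if this happens for no $v\in N$, add the edge $uw$ to the global edge set $\hat E$, add $u$ to $N$, and set $V_u=\{u\}$. Return all sets $V_u$, $u\in N$. Algorithm $\mathtt{ReconstructTree}(V)$: if $|V|>1$, call $\mathtt{ComponentsTree}(V)$ to get $V_1,\dots,V_m$ and call $\mathtt{ReconstructTree}(V_i)$ for every $i=1,\dots,m$. The global edge set $\hat E$ is initialized as $\emptyset$ and is the output. *)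

(* Defs.v *)
From HB Require Import structures.
From mathcomp Require Import all_boot all_order all_algebra.
From mathcomp Require Import reals exp.

Set Implicit Arguments.
Unset Strict Implicit.
Unset Printing Implicit Defensive.

Import Order.TTheory GRing.Theory Num.Theory.
Local Open Scope ring_scope.

Section Graphs.
Variable T : finType.
Implicit Type e : rel T.

(* The last clause forbids simple cycles; the bound on the size is needed
   because ucycle counts every edge xy as the cycle [:: x; y]. *)
Definition is_tree e : Prop :=
  [/\ symmetric e, irreflexive e, forall x y, connect e x y
    & forall c : seq T, (2 < size c)%N -> ~~ ucycleb e c].

Definition max_degree e : nat := \max_(x : T) #|[set y | e x y]|.

End Graphs.

Definition posdefmx (R : realType) n (Sigma : 'M[R]_n) : Prop :=
  Sigma^T = Sigma /\
  forall x : 'cV[R]_n, x != 0 -> 0 < (x^T *m Sigma *m x) 0 0.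

Definition concentration_graph (R : realType) n (Sigma : 'M[R]_n) : rel 'I_n :=
  fun i j => (i != j) && (invmx Sigma i j != 0).

(* Randomized programs over real registers and the vertex set 'I_n.  Each node
   other than Ret is one elementary operation.  Programs do not mention the
   covariance matrix: its entries are obtained only through Query nodes. *)
Section Programs.
Variables (R : realType) (n : nat).

Inductive arith_op : Type :=
| Add of R & R | Sub of R & R | Mul of R & R | Div of R & R
| Sqrt of R | Abs of R.

Definition eval_arith (o : arith_op) : R :=
  match o with
  | Add x y => x + y
  | Sub x y => x - y
  | Mul x y => x * y
  | Div x y => x / y
  | Sqrt x => Num.sqrt x
  | Abs x => `|x|
  end.

Inductive comparison : Type := Neq of R & R | Le of R & R | Lt of R & R.

Definition eval_comparison (c : comparison) : bool :=
  match c with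
  | Neq x y => x != y
  | Le x y => x <= y
  | Lt x y => x < y
  end.

Inductive prog (A : Type) : Type :=
| Ret of A
| Query of 'I_n & 'I_n & (R -> prog A)
| Arith of arith_op & (R -> prog A)
| Compare of comparison & (bool -> prog A)
| Sample of {set 'I_n} & ('I_n -> prog A).

Fixpoint bind (A B : Type) (p : prog A) (f : A -> prog B) : prog B :=
  match p with
  | Ret a => f a
  | Query i j k => Query i j (fun x => bind (k x) f)
  | Arith o k => Arith o (fun x => bind (k x) f)
  | Compare c k => Compare c (fun b => bind (k b) f)
  | Sample V k => Sample V (fun u => bind (k u) f)
  end.

Definition query i j : prog R := Query i j (@Ret R).
Definition arith o : prog R := Arith o (@Ret R).
Definition compare c : prog bool := Compare c (@Ret bool).
Definition sample V : prog 'I_n := Sample V (@Ret 'I_n).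

(* Probability that a run started with counters q (oracle calls) and t (time)
   ends with an output and final counters satisfying E.  Draws are uniform and
   independent.  A draw from the empty set has no outcome and contributes 0,
   i.e. such a run counts as a failure of every event. *)
Fixpoint prob_from (A : Type) (Sigma : 'M[R]_n) (E : A -> nat -> nat -> bool)
    (q t : nat) (p : prog A) : R :=
  match p with
  | Ret a => (E a q t)%:R
  | Query i j k => prob_from Sigma E q.+1 t.+1 (k (Sigma i j))
  | Arith o k => prob_from Sigma E q t.+1 (k (eval_arith o))
  | Compare c k => prob_from Sigma E q t.+1 (k (eval_comparison c))
  | Sample V k =>
      (#|V|%:R)^-1 * \sum_(u in V) prob_from Sigma E q t.+1 (k u)
  end.

Definition prob (A : Type) (Sigma : 'M[R]_n) (p : prog A)
    (E : A -> nat -> nat -> bool) : R :=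
  prob_from Sigma E 0 0 p.

End Programs.

Arguments Ret {R n A} _.
Arguments query {R n} _ _.
Arguments arith {R n} _.
Arguments compare {R n} _.
Arguments sample {R n} _.

Notation "'let*' x ':=' p 'in' q" := (bind p (fun x => q))
  (at level 200, x name, p at level 200, q at level 200,
   format "'[v' 'let*'  x  ':='  p  'in' '/' q ']'").

Section Algorithm.
Variables (R : realType) (n : nat).
Local Notation prog := (prog R n).
Local Notation vertex := 'I_n.

(* Scores of sCentral: [trials] further rounds for the vertex v, starting from
   the current value s of the score. *)
Fixpoint score_rounds (kappa : nat) (V : {set vertex}) (v : vertex)
    (trials : nat) (s : R) : prog R :=
  if trials is m.+1 then
    let* u := sample (V :\ v) in
    let* w := sample (V :\ v) in
    let* suv := query u v in
    let* svw := query v w in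
    let* suw := query u w in
    let* svv := query v v in
    let* a := arith (Mul suv svw) in
    let* b := arith (Mul suw svv) in
    let* c := arith (Sub a b) in
    let* nz := compare (Neq c 0) in
    if nz then
      let* inc := arith (Div 1 kappa%:R) in
      let* s' := arith (Add s inc) in
      score_rounds kappa V v m s'
    else score_rounds kappa V v m s
  else Ret s.

Fixpoint scores (kappa : nat) (V : {set vertex}) (vs : seq vertex) :
    prog (seq (vertex * R)) :=
  if vs is v :: vs' then
    let* s := score_rounds kappa V v kappa 0 in
    let* r := scores kappa V vs' in
    Ret ((v, s) :: r)
  else Ret [::].

Fixpoint argmin (best : vertex * R) (vs : seq (vertex * R)) : prog vertex :=
  if vs is x :: vs' then
    let* lt := compare (Lt x.2 best.2) in
    argmin (if lt then x else best) vs'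
  else Ret best.1.

(* None is returned only for V = set0. *)
Definition sCentral (kappa : nat) (V : {set vertex}) : prog (option vertex) :=
  let* r := scores kappa V (enum V) in
  if r is x :: r' then let* v := argmin x r' in Ret (Some v) else Ret None.

Fixpoint abs_correlations (w : vertex) (us : seq vertex) :
    prog (seq (vertex * R)) :=
  if us is u :: us' then
    let* suw := query u w in
    let* suu := query u u in
    let* sww := query w w in
    let* m := arith (Mul suu sww) in
    let* sq := arith (Sqrt m) in
    let* rho := arith (Div suw sq) in
    let* a := arith (Abs rho) in
    let* r := abs_correlations w us' in
    Ret ((u, a) :: r)
  else Ret [::].

Fixpoint merge_decr (s1 : seq (vertex * R)) :
    seq (vertex * R) -> prog (seq (vertex * R)) :=
  if s1 is x :: s1' then
    fix merge_s1 (s2 : seq (vertex * R)) : prog (seq (vertex * R)) :=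
      if s2 is y :: s2' then
        let* le := compare (Le y.2 x.2) in
        if le then let* r := merge_decr s1' s2 in Ret (x :: r)
        else let* r := merge_s1 s2' in Ret (y :: r)
      else Ret s1
  else fun s2 => Ret s2.

(* Merge sort; [depth] bounds the recursion depth, and depth = size s is always
   enough. *)
Fixpoint sort_decr_rec (depth : nat) (s : seq (vertex * R)) :
    prog (seq (vertex * R)) :=
  if depth is d.+1 then
    if (size s <= 1)%N then Ret s else
    let* s1 := sort_decr_rec d (take (size s)./2 s) in
    let* s2 := sort_decr_rec d (drop (size s)./2 s) in
    merge_decr s1 s2
  else Ret s.

Definition sort_decr (s : seq (vertex * R)) := sort_decr_rec (size s) s.

(* [parts] lists the pairs (v, V_v) for v in N.  The vertex u is added to V_v
   for every v in N passing the test; the boolean tells whether some v did. *)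
Fixpoint test_all (w u : vertex) (parts : seq (vertex * {set vertex})) :
    prog (bool * seq (vertex * {set vertex})) :=
  if parts is (v, Vv) :: parts' then
    let* suv := query u v in
    let* sww := query w w in
    let* suw := query u w in
    let* svw := query v w in
    let* a := arith (Mul suv sww) in
    let* b := arith (Mul suw svw) in
    let* c := arith (Sub a b) in
    let* nz := compare (Neq c 0) in
    let* r := test_all w u parts' in
    Ret (nz || r.1, (v, if nz then u |: Vv else Vv) :: r.2)
  else Ret (false, [::]).

(* Edges are two-element sets; the global edge set is threaded through. *)
Fixpoint process (w : vertex) (us : seq vertex) (E : {set {set vertex}})
    (parts : seq (vertex * {set vertex})) :
    prog ({set {set vertex}} * seq {set vertex}) :=
  if us is u :: us' then
    let* r := test_all w u parts in
    if r.1 then process w us' E r.2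
    else process w us' ([set u; w] |: E) (rcons parts (u, [set u]))
  else Ret (E, [seq p.2 | p <- parts]).

Definition ComponentsTree (kappa : nat) (E : {set {set vertex}})
    (V : {set vertex}) : prog ({set {set vertex}} * seq {set vertex}) :=
  let* ow := sCentral kappa V in
  if ow is Some w then
    let* rhos := abs_correlations w (enum (V :\ w)) in
    let* sorted_rhos := sort_decr rhos in
    process w [seq p.1 | p <- sorted_rhos] E [::]
  else Ret (E, [::]).

Fixpoint iterate_parts
    (f : {set {set vertex}} -> {set vertex} -> prog {set {set vertex}})
    (E : {set {set vertex}}) (Vs : seq {set vertex}) : prog {set {set vertex}} :=
  if Vs is V :: Vs' then let* E' := f E V in iterate_parts f E' Vs' else Ret E.

(* [depth] bounds the recursion depth.  All sets returned by ComponentsTree on V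
   are subsets of V minus one vertex, so depth = #|V| is never exhausted at a
   call that still has to recurse. *)
Fixpoint ReconstructTree_rec (kappa depth : nat) (E : {set {set vertex}})
    (V : {set vertex}) : prog {set {set vertex}} :=
  if depth is m.+1 then
    let* big := compare (Lt 1 #|V|%:R) in
    if big then
      let* r := ComponentsTree kappa E V in
      iterate_parts (ReconstructTree_rec kappa m) r.1 r.2
    else Ret E
  else Ret E.

Definition ReconstructTree (kappa : nat) (V : {set vertex}) :
    prog {set {set vertex}} :=
  ReconstructTree_rec kappa #|V| set0 V.

End Algorithm.

(* Main.v *)
(* For v <> w, the vector sigma_ww sigma_.v - sigma_vw sigma_.w is mapped by K
   to a combination of the basis vectors at v and w, and energy arguments for K
   on the branches of the tree show that it vanishes exactly off the component
   of v in T - w.  So the tests of the algorithm decide connectivity in T - w: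
   whatever the order of processing, ComponentsTree(V) returns the components
   of V - w, and its list N never exceeds the degree of w.

   A centroid v of V has s(v) <= 2/3 when |V| >= 3, while s(v) >= 63/64 as soon
   as one component of V - v exceeds 127/128 |V|.  By Chernoff's bound at the
   threshold 4/5, each score is on the wrong side with probability at most
   (31/32)^kappa <= eps / (2 n^2).  A call on V therefore fails with probability
   at most |V| eps / (2 n^2), and the induction |V| + sum |V_i|^2 <= |V|^2 over
   the recursive calls bounds the total failure probability.

   Outside failure, local work M |V| with M = O(kappa + log n + d) and pieces of
   size at most 127/128 |V| give time M k (1 + 128 ln k) by induction on k = |V|,
   since ln (127/128) <= - 1/128. *)
Require Import Defs.
From HB Require Import structures.
From mathcomp Require Import all_boot all_order all_algebra.
From mathcomp Require Import reals sequences exp.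
From mathcomp Require Import zify ring lra.
Import Order.TTheory GRing.Theory Num.Theory.
Local Open Scope ring_scope.

Set Implicit Arguments.
Unset Strict Implicit.
Unset Printing Implicit Defensive.

(** * Connectivity in a graph after deletion of a vertex *)

Section VertexDeletion.
Variable T : finType.
Implicit Types (e : rel T) (V : {set T}).

Definition avoid e w : rel T := [rel x y | [&& x != w, y != w & e x y]].

Lemma connect_avoid_sym e w : symmetric e -> connect_sym (avoid e w).
Proof.
move=> es; apply: sym_connect_sym => x y.
by rewrite /avoid /= es !andbA [(x != w) && _]andbC.
Qed.

Lemma connect_avoid_neq e w x y :
  x != w -> connect (avoid e w) x y -> y != w.
Proof.
move=> xw /connectP[p + ->]; elim: p x xw => //= a p IH x xw /andP[/and3P[_ aw _]].
exact: IH.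
Qed.

(** Every vertex on a path from x off w is reachable from x off w, so v is not among them and the
    same path avoids v. *)
Lemma connect_avoid_switch e w v x y :
  connect (avoid e w) x y -> ~~ connect (avoid e w) x v ->
  connect (avoid e v) x y.
Proof.
case/connectP=> p + ->; elim: p x => //= a p IH x /andP[xa pa] nxv.
have nav : ~~ connect (avoid e w) a v.
  by apply: contra nxv; apply: connect_trans; apply: connect1.
apply: connect_trans (IH a pa nav); apply: connect1.
rewrite /avoid /=; case/and3P: xa => _ _ ->; rewrite andbT.
by apply/andP; split; [apply: contraNneq nxv | apply: contraNneq nav] => ->.
Qed.

Lemma connect_exit e x w :
  connect e x w -> x != w -> exists2 y, e y w & connect (avoid e w) x y.
Proof.
case/connectP=> p pxp lw; elim: p x pxp lw => [|a p IH] x /=.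
  by move=> _ ->; rewrite eqxx.
case/andP=> exa pap lw xw; have [aw | aw] := eqVneq a w.
  by exists x; rewrite ?connect0 // -aw.
have [y yw ay] := IH a pap lw aw; exists y => //.
by apply: connect_trans ay; apply: connect1; rewrite /avoid /= xw aw.
Qed.

Lemma sub_connect_avoid e e' w x y :
  subrel e' e -> connect (avoid e' w) x y -> connect (avoid e w) x y.
Proof.
move=> sub; apply: connect_sub => a b /and3P[aw bw /sub ab].
by apply: connect1; rewrite /avoid /= aw bw.
Qed.

(** Otherwise a simple path from b to c off a, closed up through a, would be a cycle of length at
    least 3. *)
Lemma tree_neighbor_uniq e a b c :
  is_tree e -> e a b -> e a c -> connect (avoid e a) b c -> b = c.
Proof.
case=> es ei _ ecyc ab ac /connectP[p pbp lc].
case/shortenP: pbp lc => p' pb' up _ lc.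
case: p' pb' up lc => [_ _ -> // | x p' pb' up lc].
have := ecyc [:: a, b, x & p'] isT; case/negP; rewrite /ucycleb.
have na : all [pred y | y != a] [:: b, x & p'].
  have : b != a by apply: contraTneq ab => ->; rewrite ei.
  clear up lc ab; elim: (x :: p') b pb' => [|y q IH] b /=; first by move=> _ ->.
  by case/andP=> /and3P[_ yw _] pq ->; apply: IH.
apply/andP; split.
  rewrite /= in lc; rewrite /cycle /= ab rcons_path -lc [e c a]es ac andbT.
  by apply: (@sub_path _ _ e _ b (x :: p') pb') => u v /and3P[].
rewrite cons_uniq up andbT; apply/negP => /(allP na); by rewrite /= eqxx.
Qed.

End VertexDeletion.

(** * Conditional covariances on a tree and their zeros *)

Section TreeCovariance.
Variables (R : realType) (n : nat) (Sigma : 'M[R]_n).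
Hypothesis Sigma_pd : posdefmx Sigma.
Local Notation e := (concentration_graph Sigma).
Local Notation K := (invmx Sigma).
Hypothesis tree : is_tree e.

Lemma posdefmx_unit : Sigma \in unitmx.
Proof.
rewrite -unitmx_tr -row_free_unit -kermx_eq0.
apply/eqP/row_matrixP => i; rewrite row0; apply/eqP/contraT => ki.
have Sx0 : Sigma *m (row i (kermx Sigma^T))^T = 0.
  by apply: trmx_inj; rewrite trmx_mul trmxK -row_mul mulmx_ker row0 trmx0.
have := Sigma_pd.2 (row i (kermx Sigma^T))^T.
by rewrite -mulmxA Sx0 mulmx0 mxE ltxx trmx_eq0 => /(_ ki).
Qed.

Lemma covC i j : Sigma i j = Sigma j i.
Proof. by rewrite -[in LHS]Sigma_pd.1 mxE. Qed.

(** With y = K z, the sum of these products is the quadratic form of [Sigma] at y, which is positive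
    unless y = 0. *)
Lemma energy_eq0 (z : 'cV[R]_n) :
  (forall c, z c 0 * (K *m z) c 0 = 0) -> z = 0.
Proof.
move=> zKz; set y := K *m z.
have zE : z = Sigma *m y by rewrite mulKVmx // posdefmx_unit.
have [y0 | y0] := eqVneq y 0; first by rewrite zE y0 mulmx0.
have := Sigma_pd.2 _ y0; rewrite -mulmxA -zE mxE big1 ?ltxx // => c _.
by rewrite mxE mulrC zKz.
Qed.

(** The entry at a is [Sigma w w] times the Gaussian conditional covariance of a and v given w;
    keeping this factor avoids division and matches the tests of the algorithm. *)
Definition cond_cov w v : 'cV[R]_n :=
  \col_a (Sigma w w * Sigma a v - Sigma v w * Sigma a w).

Lemma cond_covE w v a :
  cond_cov w v a 0 = Sigma w w * Sigma a v - Sigma v w * Sigma a w.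
Proof. by rewrite mxE. Qed.

Lemma inv_cond_cov w v a :
  (K *m cond_cov w v) a 0 = Sigma w w * (a == v)%:R - Sigma v w * (a == w)%:R.
Proof.
have -> : cond_cov w v = Sigma w w *: col v Sigma - Sigma v w *: col w Sigma.
  by apply/matrixP => i j; rewrite !mxE.
rewrite mulmxBr -!scalemxAr !colE !mulKmx ?posdefmx_unit //.
by rewrite !mxE !andbT.
Qed.

Lemma inv_cond_cov0 w v a :
  a != v -> a != w -> (K *m cond_cov w v) a 0 = 0.
Proof.
by move=> /negPf av /negPf aw; rewrite inv_cond_cov av aw !mulr0 subr0.
Qed.

Lemma cond_cov_center w v : cond_cov w v w 0 = 0.
Proof. by rewrite cond_covE covC mulrC subrr. Qed.

Lemma cov_gt0 w : 0 < Sigma w w.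
Proof.
have := Sigma_pd.2 (delta_mx w 0).
rewrite trmx_delta -rowE -colE !mxE; apply.
by apply/eqP => /matrixP/(_ w 0)/eqP; rewrite !mxE !eqxx oner_eq0.
Qed.

Definition branch w r : pred 'I_n := [pred c | connect (avoid e w) r c].

Definition restrict_to (A : pred 'I_n) (f : 'cV[R]_n) : 'cV[R]_n :=
  \col_c (if A c then f c 0 else 0).

(** The only vertex outside the branch that can be adjacent to a vertex inside is w, so truncation
    removes from row c just the term of w. *)
Lemma inv_restrict_branch w r (f : 'cV[R]_n) c : r != w -> branch w r c ->
  (K *m restrict_to (branch w r) f) c 0 = (K *m f) c 0 - K c w * f w 0.
Proof.
move=> rw rc; have cw : c != w := connect_avoid_neq rw rc.
rewrite !mxE (bigD1 w) //= [in RHS](bigD1 w) //= addrAC subrr add0r mxE.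
have /negPf -> : ~~ branch w r w.
  by apply/negP => /(connect_avoid_neq rw); rewrite eqxx.
rewrite mulr0 add0r; apply: eq_bigr => b bw; rewrite mxE.
case: ifPn => // nb; have [-> | Kcb] := eqVneq (K c b) 0; first by rewrite !mul0r.
case/negP: nb; have [<- // | cb] := eqVneq c b.
apply: connect_trans rc (connect1 _).
by rewrite /avoid /= cw bw /concentration_graph cb.
Qed.

(** On the branch of u the vector K [cond_cov w v] vanishes, and truncation changes nothing there
    because [cond_cov] is 0 at w. The truncated vector therefore has zero energy. *)
Lemma cond_cov_separated w v u :
  u != w -> ~~ connect (avoid e w) u v -> cond_cov w v u 0 = 0.
Proof.
move=> uw nuv; set z := restrict_to (branch w u) (cond_cov w v).
suff /matrixP/(_ u 0) : z = 0 by rewrite [LHS]mxE /branch /= connect0 [RHS]mxE.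
apply: energy_eq0 => c; rewrite [X in X * _]mxE.
case: ifPn => [uc | _]; last by rewrite mul0r.
rewrite inv_restrict_branch // cond_cov_center mulr0 subr0 inv_cond_cov0 ?mulr0 //.
  by apply: contraNneq nuv => <-.
exact: connect_avoid_neq uw uc.
Qed.

(* If the value at b vanished, the restriction to the branch of b beyond a
   would have zero energy. *)
Lemma cond_cov_step w v a b :
  v != w -> b != w -> b != v -> e a b -> ~~ connect (avoid e a) b v ->
  cond_cov w v a 0 != 0 -> cond_cov w v b 0 != 0.
Proof.
move=> vw bw bv ab nbv fa; apply/eqP => fb.
have ba : b != a by move: ab => /andP[]; rewrite eq_sym.
set z := restrict_to (branch a b) (cond_cov w v).
have z0 : z = 0.
  apply: energy_eq0 => c; rewrite [X in X * _]mxE.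
  case: ifPn => [bc | _]; last by rewrite mul0r.
  have [-> | cw] := eqVneq c w; first by rewrite cond_cov_center mul0r.
  rewrite inv_restrict_branch // inv_cond_cov0 //; last by apply: contraNneq nbv => <-.
  have [-> | cb] := eqVneq c b; first by rewrite fb mul0r.
  (* Truncation affects only rows of neighbours of a, and the only neighbour of a in this branch is
     b, where the vector is assumed to vanish. *)
  have [Kca | Kca] := eqVneq (K c a) 0; first by rewrite Kca mul0r subr0 mulr0.
  have ca : c != a := connect_avoid_neq ba bc.
  have ac : e a c by case: tree => -> _ _ _; rewrite /concentration_graph ca.
  by move: cb; rewrite (tree_neighbor_uniq tree ab ac bc) eqxx.
(* Row b now reads [K b a] times the value at a equals 0, which contradicts the edge between a and
   b. *)
have := inv_restrict_branch (cond_cov w v) ba (connect0 _ b : branch a b b).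
rewrite -/z z0 mulmx0 mxE inv_cond_cov0 // sub0r => /esym/eqP.
rewrite oppr_eq0 mulf_eq0 (negPf fa) orbF => /eqP Kba.
have : e b a by case: tree => -> _ _ _.
by rewrite /concentration_graph Kba eqxx andbF.
Qed.

Lemma cond_cov_self w v : v != w -> cond_cov w v v 0 != 0.
Proof.
move=> vw; apply/eqP => fv.
have f0 : cond_cov w v = 0.
  apply: energy_eq0 => c; have [-> | cv] := eqVneq c v; first by rewrite fv mul0r.
  have [-> | cw] := eqVneq c w; first by rewrite cond_cov_center mul0r.
  by rewrite inv_cond_cov0 // mulr0.
have := inv_cond_cov w v v; rewrite f0 mulmx0 mxE eqxx (negPf vw) mulr1 mulr0.
by rewrite subr0 => /esym/eqP; rewrite gt_eqF // cov_gt0.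
Qed.

(** Nonvanishing propagates from v edge by edge along a simple path off w. Simplicity ensures that
    each new vertex b is cut off from v by its predecessor a, as [cond_cov_step] requires. *)
Lemma cond_cov_connected w v u :
  v != w -> connect (avoid e w) v u -> cond_cov w v u 0 != 0.
Proof.
move=> vw /connectP[p + ->]; case/shortenP=> {p} p + + _.
elim/last_ind: p => [|p b IH] /=; first by rewrite cond_cov_self.
rewrite rcons_path last_rcons => /andP[vp /and3P[aw bw ab]].
rewrite -/(uniq (v :: rcons p b)) -rcons_cons rcons_uniq => /andP[bp up].
have bv : b != v by apply: contraNneq bp => ->; rewrite mem_head.
apply: (cond_cov_step vw bw bv ab _ (IH vp up)).
case/lastP: p {IH} vp up ab bp aw => [|p a] /= vp up ab bp aw.
  have ba : b != v by [].
  by apply/negP => /(connect_avoid_neq ba); rewrite eqxx.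
move: up; rewrite -/(uniq (v :: rcons p a)) -rcons_cons rcons_uniq => /andP[ap up].
move: vp ab bp aw; rewrite last_rcons rcons_path -rcons_cons mem_rcons.
move=> /andP[vp /and3P[_ _ a'a]] ab bp aw.
apply/negP => bv'.
have va' : connect (avoid e a) v (last v p).
  have: all (predC1 a) (v :: p).
    by apply/allP => x xp; apply: contraNneq ap => <-.
  elim: p v vp {up ap bp a'a vw bv bv'} => //= x p IH v /andP[/and3P[_ _ vx] xp].
  case/and3P=> va xa pa; apply: connect_trans (IH x xp _); last by rewrite /= xa.
  by apply: connect1; rewrite /avoid /= va xa.
have aa' : e a (last v p) by case: tree => -> _ _ _.
(* If b reached v off a, then b and the vertex preceding a would be neighbours of a joined off a,
   hence equal, and the path would repeat a vertex. *)
have := tree_neighbor_uniq tree ab aa' (connect_trans bv' va') => bE.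
by move: bp; rewrite inE bE mem_last orbT.
Qed.

Lemma cond_cov_neq0 w v u : u != w -> v != w ->
  (cond_cov w v u 0 != 0) = connect (avoid e w) u v.
Proof.
move=> uw vw; have [cuv | ncuv] := boolP (connect _ u v).
  rewrite cond_cov_connected // connect_avoid_sym //; by case: tree.
by rewrite cond_cov_separated ?eqxx.
Qed.

End TreeCovariance.

(** * Pieces of a subtree, their number and sizes, and centroids *)

Section Centroid.
Variables (T : finType) (e : rel T).
Hypothesis tree : is_tree e.
Implicit Types V : {set T}.

(** Connectivity is taken in the whole tree and not inside V, since this is what the covariance
    tests detect. *)
Definition piece V w r : {set T} := [set x in V :\ w | connect (avoid e w) r x].

(* A set containing every vertex that separates two of its members is the
   vertex set of a subtree. *)
Definition separator_closed V : Prop :=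
  forall x y v, x \in V -> y \in V -> v \notin V -> connect (avoid e v) x y.

Let e_sym : symmetric e. Proof. by case: tree. Qed.
Let avoidC w : connect_sym (avoid e w) := connect_avoid_sym w e_sym.

(** A vertex v of V other than w and outside the piece lies in another component, so paths off w
    between members of the piece miss it. *)
Lemma separator_closed_piece V w r :
  separator_closed V -> separator_closed (piece V w r).
Proof.
move=> Vc x y v; rewrite !inE => /andP[/andP[xw xV] rx] /andP[/andP[yw yV] ry] vP.
have xy : connect (avoid e w) x y by rewrite (connect_trans _ ry) // avoidC.
have [-> // | vw] := eqVneq v w.
have [vV | vV] := boolP (v \in V); last exact: Vc.
apply: (connect_avoid_switch xy); apply: contra vP => xv.
by rewrite vw vV (connect_trans rx).
Qed.

(** Sending each u to a neighbour of w in its own component is injective on N. *)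
Lemma card_separated_le w (N : seq T) : uniq N -> w \notin N ->
  {in N &, forall u v, connect (avoid e w) u v -> u = v} ->
  (size N <= max_degree e)%N.
Proof.
move=> Nu wN sepN.
have nbr u : u \in N -> exists2 y, e y w & connect (avoid e w) u y.
  move=> uN; apply: connect_exit; first by case: tree.
  by apply: contraNneq wN => <-.
pose g u := odflt u [pick y | e y w && connect (avoid e w) u y].
have gP u : u \in N -> e (g u) w /\ connect (avoid e w) u (g u).
  rewrite /g => /nbr[y yw uy]; case: pickP => [z /andP[] // | /(_ y)].
  by rewrite yw uy.
have ginj : {in N &, injective g}.
  move=> u v uN vN guv; apply: sepN => //.
  have [[_ ug] [_ vg]] := (gP u uN, gP v vN).
  by apply: connect_trans ug _; rewrite guv avoidC.
rewrite -(card_uniqP Nu) -(card_in_imset ginj).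
rewrite (leq_trans _ (leq_bigmax w)) // subset_leq_card //.
by apply/subsetP => _ /imsetP[u /gP[? _] ->]; rewrite inE e_sym.
Qed.

(** Were the neighbour y of v towards r outside V, then r would reach v off y through a second
    neighbour of v in the same component. *)
Lemma neighbor_toward V v r : separator_closed V -> v \in V -> r \in V ->
  r != v -> exists y, [/\ y \in V, e y v & connect (avoid e v) r y].
Proof.
move=> Vc vV rV rv; have crv : connect e r v by case: tree.
have [y yv ry] := connect_exit crv rv.
exists y; split=> //; apply: contraT => yV.
have [x xv rx] := connect_exit (Vc r v y rV vV yV) rv.
move: xv => /and3P[xy vy xv].
have rx' : connect (avoid e v) r x.
  by apply: sub_connect_avoid rx => a b /and3P[].
move: xy; rewrite (@tree_neighbor_uniq _ e v x y) ?eqxx //; try by rewrite e_sym.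
by apply: connect_trans ry; rewrite avoidC.
Qed.

(** The edge vy cuts the tree in two: the side of v consists of v and everything outside the branch
    of r at v. *)
Lemma far_side v y r x : e y v -> r != v -> connect (avoid e v) r y ->
  connect (avoid e y) x v = (x == v) || (x != v) && ~~ connect (avoid e v) r x.
Proof.
move=> yv rv ry; have [-> | xv] := eqVneq x v; first by rewrite connect0.
have yv' : v != y by case: tree => _ ei _ _; apply: contraTneq yv => ->; rewrite ei.
rewrite /=; have [rx | nrx] := boolP (connect _ r x); apply/idP => /=.
  move=> xvy; have [z zv xz] := connect_exit xvy xv.
  move: zv => /and3P[zy _ zv].
  have xz' : connect (avoid e v) x z.
    by apply: sub_connect_avoid xz => a b /and3P[].
  move: zy; rewrite (@tree_neighbor_uniq _ e v z y) ?eqxx //; try by rewrite e_sym.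
  rewrite avoidC; apply: connect_trans xz'; apply: connect_trans rx.
  by rewrite avoidC.
have cxv : connect e x v by case: tree.
have [z zv xz] := connect_exit cxv xv.
have nxy : ~~ connect (avoid e v) x y.
  by apply: contra nrx => xy; rewrite (connect_trans ry) // avoidC.
apply: connect_trans (connect_avoid_switch xz nxy) (connect1 _).
by rewrite /avoid /= zv yv' !andbT; apply: contraNneq nxy => <-.
Qed.

(** Choose v with smallest largest piece. If that piece P exceeded half of V, moving to the
    neighbour y of v in P would do better: the piece of y towards v is disjoint from P, and every
    other piece of y lies in P without y. *)
Lemma centroid_exists V v0 : v0 \in V -> separator_closed V ->
  exists2 v, v \in V &
    forall r, r \in V :\ v -> (2 * #|piece V v r| <= #|V|)%N.
Proof.
move=> v0V Vc; pose m v := \max_(r in V :\ v) #|piece V v r|.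
have [v vV minv] := arg_minnP m v0V; exists v => // r rVv.
have rm : (#|piece V v r| <= m v)%N by apply: (leq_bigmax_cond r rVv).
rewrite leqNgt; apply/negP => big; suff: (m v <= (m v).-1)%N by lia.
have [r' r'Vv mE] : {r' | r' \in V :\ v & m v = #|piece V v r'|}.
  by apply: eq_bigmax_cond; apply/card_gt0P; exists r.
have big' : (#|V| < 2 * #|piece V v r'|)%N by lia.
move: r'Vv; rewrite !inE => /andP[r'v r'V].
have [y [yV yv ry]] := neighbor_toward Vc vV r'V r'v.
apply: leq_trans (minv y yV) _; apply/bigmax_leqP => s.
rewrite !inE => /andP[sy sV]; rewrite mE.
have side := far_side _ yv r'v ry.
have yP : y \in piece V v r'.
  rewrite !inE yV ry !andbT; case: tree => _ ei _ _.
  by apply: contraTneq yv => ->; rewrite ei.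
have [sv | nsv] := boolP (connect (avoid e y) s v).
  suff: (#|piece V y s| + #|piece V v r'| <= #|V|)%N by lia.
  rewrite -cardsUI (_ : _ :&: _ = set0) ?cards0 ?addn0.
    by rewrite subset_leq_card //; apply/subsetP => x;
      rewrite !inE => /orP[] /andP[/andP[_ ->]].
  apply/setP => x; rewrite !inE; apply/negP => /andP[/andP[_ sx]].
  case/andP=> /andP[xv _] rx; have := side x; rewrite (negPf xv) rx /=.
  by rewrite (connect_trans _ sv) // avoidC.
suff: (#|piece V y s| < #|piece V v r'|)%N by lia.
apply: proper_card; apply/properP; split; last by exists y => //; rewrite !inE eqxx.
apply/subsetP => x; rewrite !inE => /andP[/andP[xy xV] sx].
have := side x; have -> : connect (avoid e y) x v = false.
  by apply: contraNF nsv; apply: connect_trans.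
by rewrite xV andbT; case: eqP => //= _ /esym/negbFE.
Qed.

Lemma sum_card_pieces_le V w (N : seq T) : uniq N ->
  {in N &, forall u v, connect (avoid e w) u v -> u = v} ->
  (\sum_(r <- N) #|piece V w r| <= #|V :\ w|)%N.
Proof.
move=> Nu sepN.
have -> : (\sum_(r <- N) #|piece V w r| =
    \sum_(x in V :\ w) \sum_(r <- N) connect (avoid e w) r x)%N.
  rewrite exchange_big /=; apply: eq_bigr => r _.
  by rewrite -big_mkcondr /= -sum1_card; apply: eq_bigl => x; rewrite !inE.
rewrite -sum1_card leq_sum // => x _.
have [/hasP[r rN rx] | /hasPn nN] := boolP (has (fun r => connect (avoid e w) r x) N).
  rewrite (bigD1_seq r) //= big1_seq ?addn0 ?leq_b1 // => s /andP[sr sN].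
  apply/eqP; rewrite eqb0; apply: contra sr => sx; apply/eqP; apply: sepN => //.
  by rewrite (connect_trans sx) // avoidC.
by rewrite big1_seq // => r /nN /negPf->.
Qed.

End Centroid.

(** * A calculus for time and failure probability of randomized programs *)

Section Runs.
Variables (R : realType) (n : nat) (Sigma : 'M[R]_n).
Local Notation prog := (prog R n).

Definition avg (V : {set 'I_n}) (f : 'I_n -> R) : R :=
  (#|V|%:R)^-1 * \sum_(u in V) f u.

Lemma ler_avg (V : {set 'I_n}) (f g : 'I_n -> R) : {in V, forall u, f u <=
  g u} -> avg V f <= avg V g.
Proof. by move=> fg; rewrite ler_wpM2l ?invr_ge0 ?ler0n // ler_sum. Qed.

Lemma avg_affine (V : {set 'I_n}) a b (f : 'I_n -> R) : V != set0 ->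
  avg V (fun u => a + b * f u) = a + b * avg V f.
Proof.
rewrite -card_gt0 => V0; rewrite /avg big_split /= sumr_const -mulr_sumr.
have : #|V|%:R != 0 :> R by rewrite pnatr_eq0 -lt0n.
by move=> ?; rewrite -mulr_natl; field.
Qed.

Lemma eq_avg (V : {set 'I_n}) (f g : 'I_n -> R) : {in V, f =1 g} -> avg V f = avg V g.
Proof. by move=> fg; congr (_ * _); apply: eq_bigr => u /fg. Qed.

(** Only the clock is tracked: a query costs one unit of time too, so a time bound also bounds the
    queries. *)
Fixpoint expect A (g : A -> R -> R) (t : R) (p : prog A) : R :=
  match p with
  | Ret a => g a t
  | Query i j k => expect g (t + 1) (k (Sigma i j))
  | Arith o k => expect g (t + 1) (k (eval_arith o))
  | Compare c k => expect g (t + 1) (k (eval_comparison c))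
  | Sample V k => avg V (fun u => expect g (t + 1) (k u))
  end.

Lemma expect_bind A B g t (p : prog A) (f : A -> prog B) :
  expect g t (bind p f) = expect (fun a t' => expect g t' (f a)) t p.
Proof. by elim: p t => //= V k IH t; apply: eq_avg => u _. Qed.

Lemma expect_ge0 A g t (p : prog A) :
  (forall a t', 0 <= g a t') -> 0 <= expect g t p.
Proof.
move=> g0; elim: p t => //= V k IH t.
by rewrite mulr_ge0 ?invr_ge0 ?ler0n // sumr_ge0.
Qed.

Lemma prob_from_ge A (p : prog A) (bd : R) q t : (q <= t)%N ->
  expect (fun _ t' => (t' <= bd)%R%:R) t%:R p <=
  prob_from Sigma (fun _ q' t' => (q'%:R <= bd) && (t'%:R <= bd)) q t p.
Proof.
elim: p q t => [a|i j k IH|o k IH|c k IH|V k IH] q t qt /=; last first.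
  by apply: ler_avg => u _; rewrite natr1; apply: IH; apply: leqW.
- by rewrite natr1; apply: IH; apply: leqW.
- by rewrite natr1; apply: IH; apply: leqW.
- by rewrite natr1; apply: IH.
rewrite andb_idl //; apply: le_trans; by rewrite ler_nat.
Qed.

(* With probability at least 1 - delta, p outputs a value satisfying Q within
   time c; stated through nonnegative continuations g so that it composes. *)
Definition ensures A (p : prog A) (Q : A -> Prop) (c delta : R) : Prop :=
  forall (g : A -> R -> R) (t b : R), (forall a t', 0 <= g a t') -> b <= 1 ->
    (forall a t', Q a -> t' <= t + c -> b <= g a t') -> b - delta <= expect g t p.

Lemma ensures_weaken A (p : prog A) (Q Q' : A -> Prop) c c' delta delta' :
  ensures p Q c delta -> (forall a, Q a -> Q' a) -> c <= c' -> delta <= delta' ->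
  ensures p Q' c' delta'.
Proof.
move=> pQ QQ' cc' dd' g t b g0 b1 gb.
apply: le_trans (pQ g t b g0 b1 _); first by rewrite lerD2l lerN2.
by move=> a t' /QQ' Qa t'c; apply: gb => //; apply: le_trans t'c _; rewrite lerD2l.
Qed.

Lemma ensures_ret A (a : A) (Q : A -> Prop) c delta :
  Q a -> 0 <= c -> 0 <= delta -> ensures (Ret a : prog A) Q c delta.
Proof.
move=> Qa c0 d0 g t b g0 b1 gb /=.
by rewrite lerBlDr (le_trans (gb a t Qa _)) ?lerDl.
Qed.

(** A union bound: the run of [f], seen as a continuation of [p], is worth at least [b - d2] on
    outputs satisfying [Q]. *)
Lemma ensures_bind A B (p : prog A) (f : A -> prog B) Q Q' c1 d1 c2 d2 c d :
  ensures p Q c1 d1 -> (forall a, Q a -> ensures (f a) Q' c2 d2) ->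
  0 <= d2 -> c1 + c2 <= c -> d1 + d2 <= d -> ensures (bind p f) Q' c d.
Proof.
move=> pQ fQ d20 cc dd g t b g0 b1 gb; rewrite expect_bind.
apply: le_trans (pQ _ t (b - d2) _ _ _) => [|a t'||a t' Qa t'c].
- by rewrite -addrA -opprD lerD2l lerN2 addrC.
- exact: expect_ge0.
- by rewrite lerBlDr (le_trans b1) ?lerDl.
apply: fQ => // x t'' Qx t''c; apply: gb => //; lra.
Qed.

Lemma ensures_query A i j (k : R -> prog A) Q c d :
  ensures (k (Sigma i j)) Q (c - 1) d -> ensures (Query i j k) Q c d.
Proof.
move=> kQ g t b g0 b1 gb; apply: kQ => // a t' Qa t'c; apply: gb => //; lra.
Qed.

Lemma ensures_arith A o (k : R -> prog A) Q c d :
  ensures (k (eval_arith o)) Q (c - 1) d -> ensures (Arith o k) Q c d.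
Proof.
move=> kQ g t b g0 b1 gb; apply: kQ => // a t' Qa t'c; apply: gb => //; lra.
Qed.

Lemma ensures_compare A o (k : bool -> prog A) Q c d :
  ensures (k (eval_comparison o)) Q (c - 1) d -> ensures (Compare o k) Q c d.
Proof.
move=> kQ g t b g0 b1 gb; apply: kQ => // a t' Qa t'c; apply: gb => //; lra.
Qed.

Lemma ensures_sample A (V : {set 'I_n}) (k : 'I_n -> prog A) Q c (d : 'I_n -> R) d' :
  V != set0 -> {in V, forall u, ensures (k u) Q (c - 1) (d u)} ->
  avg V d <= d' -> ensures (Sample V k) Q c d'.
Proof.
move=> V0 kQ dd' g t b g0 b1 gb /=.
apply: le_trans (_ : avg V (fun u => b + -1 * d u) <= _).
  by rewrite avg_affine // mulN1r lerD2l lerN2.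
apply: ler_avg => u uV; rewrite mulN1r.
apply: kQ => // a t' Qa t'c; apply: gb => //; lra.
Qed.

End Runs.

(** * Concentration of the scores and the vertex chosen by [sCentral] *)

Section Centrality.
Variables (R : realType) (n : nat) (Sigma : 'M[R]_n).
Local Notation e := (concentration_graph Sigma).
Local Notation ensures := (ensures Sigma).
Implicit Types (V : {set 'I_n}) (v w : 'I_n).

Definition dependent v u w : bool :=
  Sigma u v * Sigma v w - Sigma u w * Sigma v v != 0.

(** The success probability of one trial, which is the mean of the score of v. *)
Definition centrality V v : R :=
  avg (V :\ v) (fun u => avg (V :\ v) (fun w => (dependent v u w)%:R)).

(* Chernoff's method: x is the exponential of the tilting parameter. *)
Lemma ensures_score_rounds V v kappa (x c0 : R) (Q : pred nat) m j :
  V :\ v != set0 -> 0 <= x -> 0 <= c0 ->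
  (forall i, ~~ Q i -> 1 <= c0 * x ^+ i) ->
  ensures (score_rounds kappa V v m (j%:R * (1 / kappa%:R)))
    (fun s => exists2 i, s = i%:R * (1 / kappa%:R) & Q i)
    (12%:R * m%:R) (c0 * x ^+ j * (1 + (x - 1) * centrality V v) ^+ m).
Proof.
move=> V0 x0 c00 cQ; elim: m j => [|m IH] j.
  rewrite expr0 mulr1 mulr0 /=;
    have cx0 : 0 <= c0 * x ^+ j by rewrite mulr_ge0 ?exprn_ge0.
  have [Qj | /cQ nQj] := boolP (Q j); first by apply: ensures_ret => //; exists j.
  (* A final count violating [Q] is charged a failure probability of at least 1, so the lower bound
     is nonpositive. *)
  move=> g t b g0 b1 gb /=; apply: le_trans (g0 _ _); lra.
set W := (1 + (x - 1) * centrality V v) ^+ m.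
(* A trial multiplies the failure bound by x if it succeeds and by 1 if not; averaging over both
   draws gives the factor [1 + (x - 1) * centrality V v]. *)
apply: (ensures_sample (d := fun u => avg (V :\ v) (fun w =>
  c0 * x ^+ j * W * (1 + (x - 1) * (dependent v u w)%:R)))) => //; last first.
  rewrite (eq_avg (g := fun u => c0 * x ^+ j * W +
     c0 * x ^+ j * W * (x - 1) * avg (V :\ v) (fun w => (dependent v u w)%:R))).
    by rewrite avg_affine // -/(centrality V v) exprSr -/W; rewrite le_eqVlt;
      apply/orP; left; apply/eqP; ring.
  move=> u _; rewrite -avg_affine //; apply: eq_avg => w _; ring.
move=> u uV; apply: ensures_sample => // w wV.
do 4!apply: ensures_query; do 3!apply: ensures_arith; apply: ensures_compare.
rewrite [eval_comparison _]/= -/(dependent v u w).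
case: dependent.
  do 2!apply: ensures_arith.
  have -> : eval_arith (Add (j%:R * (1 / kappa%:R)) (eval_arith (Div 1 kappa%:R))) =
     j.+1%:R * (1 / kappa%:R) :> R. by rewrite /= -natr1 mulrDl !mul1r.
  apply: ensures_weaken (IH j.+1) _ _ _ => //; first by rewrite -natr1; lra.
  rewrite -/W (_ : 1 + (x - 1) * true%:R = x); last by rewrite mulr1 addrC subrK.
  by rewrite exprSr mulrA [leRHS]mulrAC.
apply: ensures_weaken (IH j) _ _ _ => //; first by rewrite -natr1; lra.
by rewrite mulr0 addr0 mulr1.
Qed.

Definition balanced V v : bool :=
  [forall r in V :\ v, (3 * #|piece e V v r| <= 2 * (#|V| - 1))%N].

Definition lopsided V v : bool :=
  [exists r in V :\ v, (127 * #|V| < 128 * #|piece e V v r|)%N].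

Lemma lopsided_balanced V v : lopsided V v -> balanced V v -> False.
Proof.
case/exists_inP=> r rV big /forall_inP/(_ r rV); lia.
Qed.

Hypothesis Sigma_pd : posdefmx Sigma.
Hypothesis tree : is_tree e.

Lemma dependentE v u w : u != v -> w != v ->
  dependent v u w = connect (avoid e v) u w.
Proof.
move=> uv wv; rewrite -(cond_cov_neq0 Sigma_pd tree) // cond_covE.
rewrite /dependent !subr_eq0 eq_sym (covC Sigma_pd v w).
by rewrite [Sigma v v * _]mulrC [Sigma w v * _]mulrC.
Qed.

Lemma centralityE V v : centrality V v =
  (#|V :\ v|%:R)^-1 ^+ 2 * (\sum_(u in V :\ v) #|piece e V v u|)%:R.
Proof.
rewrite /centrality {1}/avg expr2 -mulrA; congr (_ * _).
rewrite natr_sum mulr_sumr; apply: eq_bigr => u uV.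
rewrite /avg; congr (_ * _); rewrite -natr_sum; congr (_%:R).
rewrite -sum1_card.
rewrite [RHS](eq_bigl (fun w => (w \in V :\ v) && connect (avoid e v) u w)).
  rewrite [RHS]big_mkcondr; apply: eq_bigr => w wV.
  by rewrite dependentE ?(setD1P uV).1 ?(setD1P wV).1.
by move=> w; rewrite !inE.
Qed.

Lemma centrality_balanced V v : V :\ v != set0 -> v \in V -> balanced V v ->
  0 <= centrality V v <= 2 / 3.
Proof.
rewrite -card_gt0 => V0 vV /forall_inP bal; rewrite centralityE.
rewrite mulr_ge0 ?exprn_ge0 ?invr_ge0 //=.
set m := #|V :\ v| in V0 *; have m0 : 0 < m%:R :> R by rewrite ltr0n.
have km : #|V| = m.+1 by rewrite (cardsD1 v) vV.
rewrite exprVn mulrC ler_pdivrMr ?exprn_gt0 // mulrAC ler_pdivlMr //.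
rewrite -natrX -!natrM ler_nat big_distrl /=.
have -> : (2 * m ^ 2 = \sum_(u in V :\ v) (2 * m))%N
  by rewrite sum_nat_const -/m -mulnn mulnCA.
by apply: leq_sum => u uV; have := bal u uV; rewrite km subn1 mulnC.
Qed.

(** The pairs inside the large piece alone have a share above (127/128)^2 > 63/64. *)
Lemma centrality_lopsided V v : v \in V -> lopsided V v ->
  63 / 64 <= centrality V v <= 1.
Proof.
move=> vV /exists_inP[r rV big]; rewrite centralityE.
set m := #|V :\ v|; have km : #|V| = m.+1 by rewrite (cardsD1 v) vV.
have piece_le u : (#|piece e V v u| <= m)%N.
  by rewrite subset_leq_card //; apply/subsetP => x /setIdP[].
have m0 : 0 < m%:R :> R by rewrite ltr0n; have := piece_le r; lia.
rewrite exprVn [(_ ^+ 2)^-1 * _]mulrC ler_pdivlMr ?exprn_gt0 //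
  ler_pdivrMr ?exprn_gt0 //.
rewrite mulrAC ler_pdivrMr // mul1r -natrX -!natrM !ler_nat.
apply/andP; split; last first.
  by rewrite -mulnn -sum_nat_const; apply: leq_sum.
have : (#|piece e V v r| ^ 2 <= \sum_(u in V :\ v) #|piece e V v u|)%N.
  have sub : piece e V v r \subset V :\ v by apply/subsetP => x /setIdP[].
  rewrite -mulnn -sum_nat_const [leqRHS](big_setID (piece e V v r)) /= (setIidPr sub).
  apply: leq_trans (leq_addr _ _); apply: leq_sum => u; rewrite inE => /andP[_ ru].
  rewrite subset_leq_card //; apply/subsetP => x; rewrite !inE => /andP[-> rx] /=.
  apply: connect_trans rx; rewrite connect_avoid_sym //; by case: tree.
nia.
Qed.

Definition score_sound V v (s : R) : Prop :=
  (balanced V v -> s <= 4 / 5) /\ (lopsided V v -> 4 / 5 < s).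

Lemma ensures_score kappa V v : (0 < kappa)%N -> v \in V -> (2 <= #|V|)%N ->
  ensures (score_rounds kappa V v kappa 0) (score_sound V v)
    (12%:R * kappa%:R) ((31 / 32) ^+ kappa).
Proof.
move=> k0 vV V2; have k0R : 0 < kappa%:R :> R by rewrite ltr0n.
have V0 : V :\ v != set0 by rewrite -card_gt0; move: V2; rewrite (cardsD1 v) vV.
have -> : 0 = 0%:R * (1 / kappa%:R) :> R by rewrite mul0r.
have [bal | nbal] := boolP (balanced V v).
  have /andP[p0 p1] := centrality_balanced V0 vV bal.
  (* Fifth and fourth powers encode the threshold 4/5: [c0 * x ^+ i] is 8/7 to the power 5 i - 4
     kappa. The rate is (7/8)^4 (1 + ((8/7)^5 - 1) 2/3) < 31/32. *)
  apply: (ensures_weaken (ensures_score_rounds 0 (x := (8 / 7) ^+ 5)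
    (c0 := (7 / 8) ^+ (4 * kappa)) (Q := fun i =>
      (5 * i <= 4 * kappa)%N) V0 _ _ _)) => //.
  - by rewrite exprn_ge0 //; lra.
  - by rewrite exprn_ge0 //; lra.
  - move=> i; rewrite -ltnNge => ik; rewrite -exprM -(subnKC (ltnW ik)) exprD mulrA.
    rewrite -exprMn (_ : 7 / 8 * (8 / 7) = 1 :> R); last by field.
    by rewrite expr1n mul1r exprn_ege1 //; lra.
  - move=> _ [i -> Qi]; split=> [_ | /lopsided_balanced/(_ bal)] //.
    rewrite mulrA mulr1 ler_pdivrMr // mulrAC ler_pdivlMr //.
    by rewrite -!natrM ler_nat; lia.
  - rewrite expr0 mulr1 exprM -exprMn lerXn2r // ?nnegrE; nra.
have [lop | nlop] := boolP (lopsided V v).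
  have /andP[p0 p1] := centrality_lopsided vV lop.
  (* The lower tail needs x < 1; here the rate is at most 16 (1 - (31/32) (63/64)) < 31/32. *)
  apply: (ensures_weaken (ensures_score_rounds 0 (x := (1 / 2) ^+ 5)
    (c0 := 2 ^+ (4 * kappa)) (Q := fun i => (4 * kappa < 5 * i)%N) V0 _ _ _)) => //.
  - by rewrite exprn_ge0 //; lra.
  - by rewrite exprn_ge0 //; lra.
  - move=> i; rewrite -leqNgt => ik; rewrite -exprM -{1}(subnK ik) exprD -mulrA.
    rewrite -exprMn (_ : 2 * (1 / 2) = 1 :> R); last by field.
    by rewrite expr1n mulr1 exprn_ege1 //; lra.
  - move=> _ [i -> Qi]; split=> [bal | _]; first by case/negP: nbal.
    rewrite mulrA mulr1 ltr_pdivlMr // mulrAC ltr_pdivrMr //.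
    by rewrite -!natrM ltr_nat; lia.
  - rewrite expr0 mulr1 exprM -exprMn lerXn2r // ?nnegrE; nra.
apply: (ensures_weaken (ensures_score_rounds 0 (x := 0)
    (c0 := 0) (Q := predT) V0 _ _ _)) => //.
  by move=> s _; rewrite /score_sound (negPf nbal) (negPf nlop).
by rewrite !mul0r exprn_ge0 //; lra.
Qed.

Lemma ensures_scores kappa V (vs : seq 'I_n) : (0 < kappa)%N -> (2 <= #|V|)%N ->
  {subset vs <= V} ->
  ensures (scores R kappa V vs)
    (fun r => map fst r = vs /\ {in r, forall x, score_sound V x.1 x.2})
    (12%:R * kappa%:R * (size vs)%:R) ((size vs)%:R * (31 / 32) ^+ kappa).
Proof.
move=> k0 V2; elim: vs => [|v vs IH] vsV /=.
  by apply: ensures_ret; rewrite ?mulr0 ?mul0r.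
have d0 : 0 <= (31 / 32) ^+ kappa :> R by rewrite exprn_ge0 //; lra.
have vV : v \in V by apply: vsV; rewrite mem_head.
apply: ensures_bind (ensures_score k0 vV V2) _ _ _ _ => [s sP|||].
- apply: ensures_bind (IH _) _ _ _ _ => [x xvs|r [rvs rP]|||].
  + by apply: vsV; rewrite inE xvs orbT.
  + apply: (@ensures_ret _ _ _ _ _ _ 0 0) => //=; split; first by rewrite rvs.
    by move=> x; rewrite inE => /orP[/eqP -> // | /rP].
  + exact: lexx.
  + exact: lexx.
  + exact: lexx.
- by rewrite addr0 mulr_ge0.
- by rewrite -natr1 addr0; lra.
- by rewrite -natr1 addr0; lra.
Qed.

Lemma ensures_argmin (best : 'I_n * R) vs :
  ensures (argmin best vs)
    (fun w => exists2 s, (w, s) \in best :: vs &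
              {in best :: vs, forall x, s <= x.2})
    (size vs)%:R 0.
Proof.
elim: vs best => [|x vs IH] best /=.
  apply: ensures_ret => //; exists best.2;
    first by rewrite -surjective_pairing mem_head.
  by move=> y; rewrite inE => /eqP ->.
apply: ensures_compare; apply: ensures_weaken (IH _) _ _ _ => //; last first.
  by rewrite -natr1; lra.
move=> w [s ws min] /=; exists s.
  move: ws; rewrite !inE; case: ifP => _ /orP[] -> //; by rewrite ?orbT.
have := min _ (mem_head _ _); rewrite [eval_comparison _]/=.
case: ltP => [lt | le] sb y; rewrite !inE => /or3P[/eqP ->|/eqP ->|yvs] //;
  try by apply: min; rewrite inE yvs orbT.
- by apply: ltW; apply: le_lt_trans lt.
- by apply: le_trans le.
Qed.

(** If all scores are sound, a lopsided vertex scores above 4/5 while a centroid scores at most 4/5,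
    so a minimizer cannot be lopsided. *)
Lemma ensures_sCentral kappa V : (0 < kappa)%N -> (2 <= #|V|)%N ->
  separator_closed e V ->
  ensures (sCentral R kappa V)
    (fun ow => exists w, [/\ ow = Some w, w \in V & ~~ lopsided V w])
    (12%:R * kappa%:R * #|V|%:R + #|V|%:R) (#|V|%:R * (31 / 32) ^+ kappa).
Proof.
move=> k0 V2 Vc.
have sub : {subset enum V <= V} by move=> v; rewrite mem_enum.
apply: (ensures_bind (c2 := #|V|%:R) (d2 := 0) (ensures_scores k0 V2 sub)) =>
  [r [rV rP]|||]; last first.
- by rewrite -cardE addr0.
- by rewrite -cardE lexx.
- exact: lexx.
have memr w s : (w, s) \in r -> w \in V.
  by move=> wr; rewrite -mem_enum -rV; apply/mapP; exists (w, s).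
have szr : size r = #|V| by rewrite -(size_map fst) rV -cardE.
case: r szr rV rP memr => [|x r] szr rV rP memr; first by move: V2; rewrite -szr.
rewrite /=; apply: (ensures_bind (c2 := 0) (d2 := 0) (@ensures_argmin x r)) =>
  [w [s wr min]|||]; last first.
- by rewrite addr0.
- rewrite addr0 -szr ler_nat; exact: leqnSn.
- exact: lexx.
apply: ensures_ret => //; exists w; split; rewrite ?(memr _ s) //.
have wV := memr _ _ wr; apply/negP => lop.
(* A lopsided vertex forces |V| > 128; three vertices suffice to make a centroid balanced, by
   integrality of the piece sizes. *)
have V3 : (3 <= #|V|)%N.
  case/exists_inP: lop => r' _.
  have : (#|piece e V w r'| <= #|V :\ w|)%N.
    by rewrite subset_leq_card //; apply/subsetP => y /setIdP[].
  rewrite (cardsD1 w V) wV add1n.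
  by move: #|piece _ _ _ _| #|V :\ w| => a b; lia.
have [v vV cent] := centroid_exists tree wV Vc.
have bal : balanced V v.
  apply/forall_inP => u /cent; move: V3.
  by move: #|V| #|piece _ _ _ _| => a b; lia.
have : v \in map fst (x :: r) by rewrite rV mem_enum.
case/mapP=> y yr vE; have := min y yr; have := (rP _ wr).2 lop.
by have := (rP _ yr).1; rewrite -vE => /(_ bal) /=; lra.
Qed.

End Centrality.

(** * Cost and correctness of the splitting, and the recursion *)

Section Decomposition.
Variables (R : realType) (n : nat) (Sigma : 'M[R]_n).
Local Notation e := (concentration_graph Sigma).
Local Notation ensures := (ensures Sigma).
Implicit Types (V D : {set 'I_n}) (v w : 'I_n).

Lemma ensures_abs_correlations w us :
  ensures (abs_correlations R w us) (fun r => map fst r = us)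
    (7%:R * (size us)%:R) 0.
Proof.
elim: us => [|u us IH]; first by apply: ensures_ret; rewrite ?mulr0.
do 3!apply: ensures_query; do 4!apply: ensures_arith.
apply: (ensures_bind (c2 := 0) (d2 := 0) IH) => [r rus|||]; rewrite ?addr0 //.
  by apply: ensures_ret; rewrite //= rus.
by rewrite /= -natr1; lra.
Qed.

Lemma ensures_merge_decr (s1 s2 : seq ('I_n * R)) :
  ensures (merge_decr s1 s2) (fun r => perm_eq r (s1 ++ s2))
    ((size s1)%:R + (size s2)%:R) 0.
Proof.
elim: s1 s2 => [|x s1 IH1] s2.
  by apply: ensures_ret; rewrite ?addr_ge0.
elim: s2 => [|y s2 IH2].
  by apply: ensures_ret; rewrite ?addr_ge0 // cats0.
apply: ensures_compare; case: ifP => _.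
  apply: (ensures_bind (c2 := 0) (d2 := 0) (IH1 (y :: s2))) => [r rs|||];
    rewrite ?addr0 //.
    by apply: ensures_ret; rewrite //= perm_cons.
  by rewrite /= -!natr1; lra.
apply: (ensures_bind (c2 := 0) (d2 := 0) IH2) => [r rs|||]; rewrite ?addr0 //.
  apply: ensures_ret => //.
  apply: (@perm_trans _ (y :: (x :: s1) ++ s2));
    last exact/permPl/(perm_catCA [:: y] (x :: s1) s2).
  by rewrite perm_cons.
by rewrite /= -!natr1; lra.
Qed.

(** Halving lowers the exponent [L] by one, and the merges on each level cost at most [size s] in
    total. *)
Lemma ensures_sort_decr_rec depth (s : seq ('I_n * R)) L :
  (size s <= 2 ^ L)%N ->
  ensures (sort_decr_rec depth s) (fun r => perm_eq r s)
    (L%:R * (size s)%:R) 0.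
Proof.
elim: depth s L => [|depth IH] s L sL.
  by apply: ensures_ret; rewrite ?mulr_ge0.
rewrite /=; case: leqP => s1; first by apply: ensures_ret; rewrite ?mulr_ge0.
case: L sL => [|L] sL; first by move: sL s1; lia.
have sz1 : size (take (size s)./2 s) = (size s)./2 by rewrite size_take;
  case: ltnP; lia.
have sz2 : size (drop (size s)./2 s) = (size s - (size s)./2)%N by rewrite size_drop.
rewrite expnS in sL.
have le1 : (size (take (size s)./2 s) <= 2 ^ L)%N by rewrite sz1; lia.
have le2 : (size (drop (size s)./2 s) <= 2 ^ L)%N by rewrite sz2; lia.
have szE : (size s)%:R =
  (size (take (size s)./2 s))%:R + (size (drop (size s)./2 s))%:R :> R.
  by rewrite -natrD sz1 sz2; congr (_%:R); lia.
apply: (ensures_bind (c2 := L%:R * (size (drop (size s)./2 s))%:R + (size s)%:R)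
  (d2 := 0) (IH _ L le1)) => [r1 p1|||]; rewrite ?addr0 //; last first.
  by rewrite -natr1 {2}szE; lra.
apply: (ensures_bind (c2 := (size s)%:R) (d2 := 0) (IH _ L le2)) => [r2 p2|||];
  rewrite ?addr0 //.
apply: ensures_weaken (@ensures_merge_decr r1 r2) _ _ _ => // [r rp|].
  by rewrite (perm_trans rp) // -[X in perm_eq _ X](cat_take_drop (size s)./2) perm_cat.
by rewrite (perm_size p1) (perm_size p2) -szE.
Qed.

Hypothesis Sigma_pd : posdefmx Sigma.
Hypothesis tree : is_tree e.

Lemma ensures_test_all w u D (N : seq 'I_n) : u != w -> w \notin N ->
  ensures (test_all R w u [seq (v, [set x in D | connect (avoid e w) v x]) | v <- N])
    (fun r => r = (has (fun v => connect (avoid e w) v u) N,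
      [seq (v, [set x in u |: D | connect (avoid e w) v x]) | v <- N]))
    (8%:R * (size N)%:R) 0.
Proof.
move=> uw; elim: N => [|v N IH] wN; first by apply: ensures_ret; rewrite ?mulr0.
have [vw {}wN] : v != w /\ w \notin N.
  by move: wN; rewrite inE negb_or eq_sym => /andP[].
do 4!apply: ensures_query; do 3!apply: ensures_arith; apply: ensures_compare.
rewrite [eval_comparison _]/=.
have -> : Sigma u v * Sigma w w - Sigma u w * Sigma v w != 0 = connect (avoid e w) v u.
  rewrite connect_avoid_sym; last by case: tree.
  rewrite -(cond_cov_neq0 Sigma_pd tree uw vw) cond_covE.
  by rewrite [Sigma w w * _]mulrC [Sigma v w * _]mulrC.
apply: (ensures_bind (c2 := 0) (d2 := 0) (IH wN)) => [_ ->|||]; rewrite ?addr0 //.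
  apply: ensures_ret => //=; congr (_, (_, _) :: _).
  apply/setP => x; case: ifP => vu; rewrite !inE; case: eqP => // ->;
    by rewrite vu ?andbF.
by rewrite /= -natr1; lra.
Qed.

(* What the list N of neighbours found so far satisfies once the vertices of D
   have been processed. *)
Definition representatives w D (N : seq 'I_n) : Prop :=
  [/\ uniq N, {subset N <= D}, w \notin D,
      {in N &, forall u v, connect (avoid e w) u v -> u = v} &
      {in D, forall x, has (fun v => connect (avoid e w) v x) N}].

(** The parts are kept equal to the traces on D of the components represented by N. Members of N lie
    in distinct components, so each u meets at most d tests of 8 operations. *)
Lemma ensures_process d w us E D N : (max_degree e <= d)%N ->
  representatives w D N -> w \notin us ->
  ensures (process R w us E [seq (v, [set x in D | connect (avoid e w) v x]) | v <- N])
    (fun r => exists2 N', representatives w (D :|: [set x in us]) N' &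
       r.2 = [seq [set x in D :|: [set x in us] | connect (avoid e w) v x] | v <- N'])
    (8%:R * d%:R * (size us)%:R) 0.
Proof.
move=> degd; elim: us E D N => [|u us IH] E D N repN wus.
  have -> : D :|: [set x in [::]] = D by apply/setP => x; rewrite !inE orbF.
  apply: ensures_ret => //; first by exists N => //=; rewrite -map_comp.
  by rewrite mulr0.
have [uw {}wus] : u != w /\ w \notin us.
  by move: wus; rewrite inE negb_or eq_sym => /andP[].
have [Nu ND wD sepN covN] := repN.
have wN : w \notin N by apply: contra wD; apply: ND.
have -> : D :|: [set x in u :: us] = (u |: D) :|: [set x in us].
  by apply/setP => x; rewrite !inE orbA [(x \in D) || _]orbC.
have wuD : w \notin u |: D by rewrite !inE eq_sym negb_or uw.
apply: (ensures_bind (c2 := 8%:R * d%:R * (size us)%:R) (d2 := 0)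
  (@ensures_test_all w u D N uw wN)) => [_ ->|||]; rewrite ?addr0 //; last first.
  have : (size N)%:R <= d%:R :> R.
    by rewrite ler_nat (leq_trans _ degd) // (card_separated_le tree Nu wN).
  by rewrite /= -natr1; lra.
rewrite /=; case: ifPn => [Nhas | /hasPn Nno].
  apply: IH => //; split=> //; first by move=> x /ND; rewrite !inE => ->; rewrite orbT.
  by move=> x; rewrite !inE => /orP[/eqP -> // | /covN].
have avoidC := connect_avoid_sym w (let: And4 es _ _ _ := tree in es).
(* When all tests fail, u opens a new component: every vertex of D belongs to a component already
   represented, so the new trace is u alone. *)
have -> : rcons [seq (v, [set x in D | connect (avoid e w) v x]) | v <- N] (u, [set u])
    = [seq (v, [set x in u |: D | connect (avoid e w) v x]) | v <- rcons N u].
  rewrite map_rcons; congr rcons.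
    apply/eq_in_map => v vN; congr pair; apply/setP => x; rewrite !inE.
    by case: eqP => //= ->; rewrite (negPf (Nno v vN)) andbF.
  congr pair; apply/setP => x; rewrite !inE.
  case: eqP => [-> | _] /=; first by rewrite connect0.
  apply/esym/negbTE/negP => /andP[/covN/hasP[v vN vx] ux].
  by case/negP: (Nno v vN); rewrite (connect_trans vx) // avoidC.
apply: IH => //; split=> //.
- rewrite rcons_uniq Nu andbT; apply/negP => uN.
  by have := Nno u uN; rewrite connect0.
- by move=> x; rewrite mem_rcons !inE => /orP[-> // | /ND ->]; rewrite orbT.
- move=> x y; rewrite !mem_rcons !inE.
  case/orP=> [/eqP -> | xN] /orP[/eqP -> | yN] // cxy; last exact: sepN.
    by case/negP: (Nno y yN); rewrite avoidC.
  by case/negP: (Nno x xN).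
move=> x; rewrite has_rcons !inE => /orP[/eqP -> | /covN ->]; rewrite ?connect0 //.
by rewrite orbT.
Qed.

Definition good_split V (Vs : seq {set 'I_n}) : Prop :=
  {in Vs, forall V', [/\ separator_closed e V', (0 < #|V'| < #|V|)%N &
                        (128 * #|V'| <= 127 * #|V|)%N]} /\
  (\sum_(V' <- Vs) #|V'| < #|V|)%N.

(** Per vertex: 12 kappa + 1 for [sCentral], 7 for the correlation, L for sorting and 8 d for the
    tests. *)
Lemma ensures_ComponentsTree kappa d L E V : (max_degree e <= d)%N ->
  (0 < kappa)%N -> (2 <= #|V| <= 2 ^ L)%N -> separator_closed e V ->
  ensures (ComponentsTree R kappa E V) (fun r => good_split V r.2)
    ((12%:R * kappa%:R + L%:R + 8%:R * d%:R + 8%:R) * #|V|%:R)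
    (#|V|%:R * (31 / 32) ^+ kappa).
Proof.
move=> degd k0 /andP[V2 VL] Vc.
apply: (ensures_bind (c2 := (L%:R + 8%:R * d%:R + 7%:R) * #|V|%:R) (d2 := 0)
  (ensures_sCentral Sigma_pd tree k0 V2 Vc)) => [_ [w [-> wV central]]|||];
  rewrite ?addr0 //; last by lra.
have VwE : #|V| = (size (enum (V :\ w))).+1 by rewrite -cardE (cardsD1 w) wV.
have VwR : #|V|%:R = (size (enum (V :\ w)))%:R + 1 :> R by rewrite VwE natr1.
apply: (ensures_bind (c2 := (L%:R + 8%:R * d%:R) * #|V|%:R) (d2 := 0)
  (@ensures_abs_correlations w _)) => [s sE|||]; rewrite ?addr0 //; last first.
  by rewrite VwR; lra.
have szs : size s = size (enum (V :\ w)) by rewrite -sE size_map.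
have sL : (size s <= 2 ^ L)%N by rewrite szs; apply: leq_trans VL; rewrite VwE.
apply: (ensures_bind (c2 := 8%:R * d%:R * #|V|%:R) (d2 := 0)
  (ensures_sort_decr_rec _ sL)) => [r rs|||]; rewrite ?addr0 //; last first.
  rewrite VwR szs; have : 0 <= L%:R :> R by []; lra.
set us := map _ _.
have usE : us =i V :\ w.
  by move=> x; rewrite (perm_mem (perm_map fst rs)) sE mem_enum.
have wus : w \notin us by rewrite usE !inE eqxx.
have rep0 : representatives w set0 [::] by split=> // [|x]; rewrite inE.
apply: ensures_weaken (ensures_process E degd rep0 wus) _ _ _ => //; last first.
  rewrite ler_wpM2l ?mulr_ge0 // ler_nat size_map (perm_size rs) szs VwE.
  exact: leqnSn.
have -> : set0 :|: [set x in us] = V :\ w by apply/setP => x; rewrite !inE usE !inE.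
move=> r' [N [Nu ND _ sepN _] ->].
have pieceE v : [set x in V :\ w | connect (avoid e w) v x] = piece e V w v by [].
split.
  move=> _ /mapP[v vN ->]; rewrite pieceE; have vVw := ND v vN.
  split; first exact: separator_closed_piece.
    apply/andP; split.
      by apply/card_gt0P; exists v; rewrite inE vVw connect0.
    rewrite VwE ltnS -cardE subset_leq_card //.
    by apply/subsetP => x /setIdP[].
  rewrite leqNgt; apply: contra central => big; apply/exists_inP.
  by exists v.
rewrite big_map VwE ltnS -cardE.
exact: (sum_card_pieces_le tree V Nu sepN).
Qed.

Lemma ensures_iterate_parts f E (Vs : seq {set 'I_n}) (a b : R) :
  0 <= a -> 0 <= b ->
  (forall E' V', V' \in Vs ->
     ensures (f E' V') (fun _ => True) (a * #|V'|%:R) (b * #|V'|%:R)) ->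
  ensures (iterate_parts f E Vs) (fun _ => True)
    (a * (\sum_(V' <- Vs) #|V'|)%:R) (b * (\sum_(V' <- Vs) #|V'|)%:R).
Proof.
move=> a0 b0; elim: Vs E => [|V Vs IH] E fP.
  by apply: ensures_ret; rewrite ?big_nil ?mulr0.
rewrite big_cons natrD !mulrDr.
apply: ensures_bind (fP E V (mem_head _ _)) _ _ _ _ => [E' _|||].
- by apply: IH => E'' V' V'Vs; apply: fP; rewrite inE V'Vs orbT.
- by rewrite mulr_ge0.
- exact: lexx.
- exact: lexx.
Qed.

Lemma ensures_ReconstructTree_rec kappa d L depth E V (M : R) :
  (max_degree e <= d)%N -> (0 < kappa)%N -> (0 < #|V| <= 2 ^ L)%N ->
  (#|V| <= depth)%N -> separator_closed e V ->
  12%:R * kappa%:R + L%:R + 8%:R * d%:R + 9%:R <= M ->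
  ensures (ReconstructTree_rec R kappa depth E V) (fun _ => True)
    (M * #|V|%:R * (1 + 128%:R * ln #|V|%:R)) (#|V|%:R ^+ 2 * (31 / 32) ^+ kappa).
Proof.
move=> degd k0 + + + Mge; set delta := (31 / 32) ^+ kappa.
have delta0 : 0 <= delta by rewrite exprn_ge0 //; lra.
have M9 : 9%:R <= M.
  have [k0R L0 d0] : [/\ 0 <= kappa%:R :> R, 0 <= L%:R :> R & 0 <= d%:R :> R] by [].
  by move: Mge; lra.
elim: depth E V => [|depth IH] E V /andP[V0 VL] Vd Vc; first by have := leq_trans V0 Vd.
have k1 : 1 <= #|V|%:R :> R by rewrite ler1n.
have lnk0 : 0 <= ln #|V|%:R :> R by rewrite ln_ge0.
rewrite /=; apply: ensures_compare.
rewrite [eval_comparison _]/= ltr1n; case: ltnP => [V2 | V1]; last first.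
  have -> : #|V|%:R = 1 :> R by apply/eqP; rewrite pnatr_eq1 eqn_leq V1.
  by rewrite ln1 expr1n mul1r; apply: ensures_ret => //; lra.
have V2L : (2 <= #|V| <= 2 ^ L)%N by rewrite V2.
(* With k = |V|, the parts have sizes at most k - 1 summing to at most k - 1. For failures, k + (k -
   1)^2 <= k^2 closes the induction; for time, M also pays for the comparison. *)
apply: (ensures_bind (c2 := M * 128%:R * ln #|V|%:R * (#|V|%:R - 1))
  (d2 := (#|V|%:R - 1) * delta * (#|V|%:R - 1))
  (ensures_ComponentsTree E degd k0 V2L Vc)) => [r [parts sum_parts]|||]; last first.
- rewrite -/delta; nra.
- have : 0 <= M * 128%:R * ln #|V|%:R by rewrite !mulr_ge0 //; lra.
  nra.
- by rewrite !mulr_ge0 ?subr_ge0.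
have sumR : (\sum_(V' <- r.2) #|V'|)%:R <= #|V|%:R - 1 :> R.
  by rewrite lerBrDr natr1 ler_nat.
apply: ensures_weaken (ensures_iterate_parts (a := M * 128%:R * ln #|V|%:R)
  (b := (#|V|%:R - 1) * delta) r.1 _ _ _) _ _ _ => //; last 2 first.
- by rewrite ler_wpM2l // !mulr_ge0 //; lra.
- by rewrite ler_wpM2l // !mulr_ge0 ?subr_ge0.
- by rewrite !mulr_ge0 //; lra.
- by rewrite !mulr_ge0 ?subr_ge0.
move=> E' V' /parts[V'c /andP[V'0 V'V] V'small].
have V'k : #|V'|%:R <= #|V|%:R - 1 :> R by rewrite lerBrDr natr1 ler_nat.
have V'1 : 1 <= #|V'|%:R :> R by rewrite ler1n.
apply: ensures_weaken (IH E' V' _ _ V'c) _ _ _ => //.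
- by rewrite V'0 (leq_trans _ VL) // ltnW.
- by rewrite -ltnS (leq_trans V'V).
- have lnV' : 1 + 128%:R * ln #|V'|%:R <= 128%:R * ln #|V|%:R :> R.
    have q0 : 0 < 127 / 128 :> R by lra.
    have : ln #|V'|%:R <= ln (127 / 128 * #|V|%:R) :> R.
      rewrite ler_ln ?posrE; try by lra.
      rewrite mulrAC ler_pdivlMr // mulrC -!natrM ler_nat; exact: V'small.
    rewrite lnM ?posrE; try by lra.
    have : ln (127 / 128) <= 127 / 128 - 1 :> R.
      have e127 : 127 / 128 = 1 + (127 / 128 - 1) :> R by lra.
      by rewrite {1}e127; apply: le_ln1Dx; lra.
    lra.
  rewrite mulrAC -[M * 128%:R * _]mulrA ler_wpM2r // ler_wpM2l //; lra.
- rewrite -/delta expr2 mulrAC ler_wpM2r // ler_wpM2r //.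
Qed.
End Decomposition.

(** * Numerical estimates and the final bound *)

Lemma ln2_ge (R : realType) : 1 / 2 <= ln 2 :> R.
Proof.
have : ln (2^-1) <= - (1 / 2) :> R.
  have half : 2^-1 = 1 + - (1 / 2) :> R by field.
  by rewrite {1}half; apply: le_ln1Dx; lra.
by rewrite lnV ?posrE // lerN2.
Qed.

Lemma up_log2_le (R : realType) n : (2 <= n)%N ->
  (up_log 2 n)%:R <= 2 * ln n%:R + 1 :> R.
Proof.
move=> n2; have n0 : 0 < n%:R :> R by rewrite ltr0n; lia.
have : 2 ^+ (up_log 2 n).-1 <= n%:R :> R.
  by rewrite -natrX ler_nat ltnW // up_log_gtn.
have up0 : (0 < up_log 2 n)%N by rewrite up_log_gt0; lia.
rewrite -ler_ln ?posrE ?exprn_gt0 // lnXn // -[_ *+ _.-1]mulr_natl => le_ln.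
have : (up_log 2 n).-1%:R * (1 / 2) <= (up_log 2 n).-1%:R * ln 2 :> R.
  by rewrite ler_wpM2l // ln2_ge.
have upE : (up_log 2 n)%:R = (up_log 2 n).-1%:R + 1 :> R by rewrite natr1 prednK.
by rewrite upE; lra.
Qed.

(** This follows from 31/32 <= exp (- 1/32). *)
Lemma failure_le (R : realType) kappa (X : R) : 0 < X ->
  32%:R * ln X <= kappa%:R -> (31 / 32) ^+ kappa <= X^-1.
Proof.
move=> X0 kX; rewrite -[X]lnK ?posrE // -expRN.
apply: (@le_trans _ _ (expR (- (1 / 32)) ^+ kappa)).
  rewrite lerXn2r ?nnegrE ?expR_ge0 //; first by lra.
  by have := @expR_ge1Dx R (- (1 / 32)); lra.
by rewrite -expRM_natl ler_expR; lra.
Qed.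

Theorem theorem12 :
  exists C : nat,
    forall (R : realType) (n d kappa : nat) (Sigma : 'M[R]_n) (eps : R),
      (2 <= n)%N ->
      posdefmx Sigma ->
      is_tree (concentration_graph Sigma) ->
      (max_degree (concentration_graph Sigma) <= d)%N ->
      0 < eps < 1 ->
      kappa%:Z = Num.ceil (32%:R * ln (2%:R * n%:R ^+ 2 / eps)) ->
      let bound : R :=
        C%:R * (n%:R * ln n%:R * Num.max (ln (n%:R / eps)) d%:R) in
      1 - eps <=
        prob Sigma (ReconstructTree R kappa [set: 'I_n])
          (fun _ queries time =>
             (queries%:R <= bound) && (time%:R <= bound)).
Proof.
exists (1206 * 130)%N =>
  R n d kappa Sigma eps n2 Sigma_pd tree degd /andP[eps0 eps1] kappaE.
cbv zeta; set m := Num.max _ _; set bound := (1206 * 130)%:R * _.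
set X := 2%:R * n%:R ^+ 2 / eps in kappaE.
have n2R : 2 <= n%:R :> R by rewrite ler_nat.
have n0 : 0 < n%:R :> R by lra.
have ln_n : ln 2 <= ln n%:R :> R by rewrite ler_ln ?posrE.
have ln2 := ln2_ge R.
have lnE : ln (n%:R / eps) = ln n%:R - ln eps by rewrite ln_div ?posrE.
have ln_eps : ln eps <= 0 by rewrite ln_le0 // ltW.
have XE : ln X = ln 2 + 2%:R * ln n%:R - ln eps.
  by rewrite /X ln_div ?posrE ?mulr_gt0 ?exprn_gt0 // lnM ?posrE ?exprn_gt0 //
    lnXn // mulr_natl.
have X0 : 0 < X by rewrite divr_gt0 ?mulr_gt0 ?exprn_gt0.
have kR : kappa%:R = (Num.ceil (32%:R * ln X))%:~R :> R by rewrite -kappaE.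
have k_ge : 32%:R * ln X <= kappa%:R by rewrite kR ceil_ge.
have k_lt : kappa%:R < 32%:R * ln X + 1 by rewrite kR -ltrBlDr;
  have := ceil_itv (32%:R * ln X); lra.
have k0 : (0 < kappa)%N by rewrite -(ltr0n R); lra.
have m_d : d%:R <= m by rewrite le_max lexx orbT.
have m_ln : ln n%:R - ln eps <= m by rewrite -lnE le_max lexx.
have L_le := up_log2_le R n2.
have cardT : #|[set: 'I_n]| = n by rewrite cardsT card_ord.
have TL : (0 < #|[set: 'I_n]| <= 2 ^ up_log 2 n)%N
  by rewrite cardT up_logP // (ltnW n2).
have Tc : separator_closed (concentration_graph Sigma) [set: 'I_n].
  by move=> x y v _ _; rewrite inE.
(* Since ln X <= 3 m, the left side is at most (1152 + 2 + 8) m + 22, and m >= 1/2 turns 22 into 44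
   m. *)
have Mle : 12%:R * kappa%:R + (up_log 2 n)%:R + 8%:R * d%:R + 9%:R <=
  1206%:R * m by lra.
have := ensures_ReconstructTree_rec Sigma_pd tree set0 degd k0 TL (leqnn _) Tc Mle.
rewrite /prob /ReconstructTree cardT => /(_ (fun _ t => (t <= bound)%R%:R) 0 1) run.
apply: le_trans (le_trans (run _ _ _) (@prob_from_ge R n Sigma _ _ bound 0 0 _)) => //.
(* The total failure probability is at most n^2 / X = eps / 2. *)
- rewrite lerD2l lerN2; apply: le_trans (_ : n%:R ^+ 2 * X^-1 <= _).
    by rewrite ler_wpM2l ?exprn_ge0 // failure_le.
  have -> : n%:R ^+ 2 * X^-1 = eps / 2.
    by rewrite /X; field; rewrite !gt_eqF.
  by lra.
move=> _ t _; rewrite add0r => t_le.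
suff -> : t <= bound by [].
apply: le_trans t_le _; rewrite /bound natrM.
(* As ln n >= 1/2, the factor 1 + 128 ln n is at most 130 ln n. *)
have -> : 1206%:R * 130%:R * (n%:R * ln n%:R * m) =
  1206%:R * m * n%:R * (130%:R * ln n%:R).
  by ring.
rewrite ler_wpM2l ?mulr_ge0 //; last by lra.
by apply: le_trans m_d.
Qed.
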